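(* Let $\Gamma$ be a graph and let $k\ge 2$ be an even integer. If $\Gamma$ contains an anti-$k$-partite maximal, isolated, strongly connected component, then $1+re^{\pm 2\pi i\frac{1}{k}}\in\mathrm{spec}(\Delta)$. Furthermore, if $1+re^{\pm 2\pi i\frac{1}{k}}\in\mathrm{spec}(\Delta)$ and one of the following two conditions is satisfied: (i) $k=4m$ for some $m\in\{1,2,\ldots\}$, (ii) $k=2+4m$ for some $m\in\{0,1,\ldots\}$ and $r>1$, then $\Gamma$ contains an anti-$k$-partite isolated maximal strongly connected component.
   Context: A graph $\Gamma=(V,E,w)$ is a finite weighted directed graph without loops and multiple edges; $w:V\times V\to\mathbb{R}$ is the weight function, $w_{ij}$ is the weight of the directed edge from $j$ to $i$, and $w_{ij}=0$ if and only if there is no edge from $j$ to $i$ (in particular $w_{ii}=0$). Weights may be positive or negative. The in-degree of $i$ is $d_i^{\mathrm{in}}=\sum_j w_{ij}$. The normalized Laplace operator on the space $C(V)$ of complex valued functions on $V$ is $\Delta v(i)=v(i)-\frac{1}{d_i^{\mathrm{in}}}\sum_j w_{ij}v(j)$ if $d_i^{\mathrm{in}}\neq 0$ and $\Delta v(i)=0$ otherwise. For $i\in V$ put $r(i)=\frac{\sum_{j\in V}|w_{ij}|}{|d_i^{\mathrm{in}}|}$ if $d_i^{\mathrm{in}}\ne 0$ and $r(i)=0$ if $d_i^{\mathrm{in}}=0$; let $r=\max_{i\in V}r(i)$. An induced subgraph with vertex set $V'\subseteq V$ is maximal if $r(i)=r$ for all $i\in V'$, and isolated if $w_{ij}=0$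 for all $i\in V'$ and $j\in V\setminus V'$. A strongly connected component is the subgraph induced on an equivalence class of the relation ''mutually reachable by directed paths'' (single vertices allowed). A graph (here applied to the component, regarded as a graph in its own right) is anti-$k$-partite, for $k\ge 2$ even, if $d_i^{\mathrm{in}}\neq 0$ for all its vertices $i$ and its vertex set is partitioned into $k$ nonempty subsets $V_1,\dots,V_k$, with indices read modulo $k$ (so $V_{k+1}=V_1$), such that the only edges are: edges from vertices $j\in V_{q-1}$ to vertices $i\in V_q$ with $\frac{w_{ij}}{d_i^{\mathrm{in}}}<0$; and edges from vertices $j\in V_{q+l}$ to vertices $i\in V_q$ with $\frac{w_{ij}}{d_i^{\mathrm{in}}}>0$, where $l=\frac{k}{2}-1$ and $q=1,\dots,k$. *)

(* Defs.v *)
From HB Require Import structures.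
From mathcomp Require Import all_boot all_order all_algebra.
From mathcomp Require Import complex.
From mathcomp Require Import reals trigo.

Set Implicit Arguments.
Unset Strict Implicit.
Unset Printing Implicit Defensive.

Import Order.TTheory GRing.Theory Num.Theory.

Local Open Scope ring_scope.
Local Open Scope complex_scope.

(* [weight i j] is the weight of the edge from [j] to [i] (note the order);
   it is zero exactly when there is no such edge, so the weight function
   determines the edge set and excludes multiple edges. *)
Record wdigraph (R : realType) := WDigraph {
  vertex :> finType;
  weight : vertex -> vertex -> R;
  weight_loopless : forall i, weight i i = 0 }.

Section WeightedDigraph.
Context {R : realType}.
Implicit Types (G : wdigraph R).

Definition edge G : rel G := fun j i => weight i j != 0.

Definition indeg G (i : G) : R := \sum_j weight i j.

Definition induced G (C : {set G}) : wdigraph R :=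
  @WDigraph R {i : G | i \in C} (fun i j => weight (val i) (val j))
    (fun i => weight_loopless (val i)).

Definition laplace_fun G (v : {ffun G -> R[i]^o}) : {ffun G -> R[i]^o} :=
  [ffun i => if indeg i != 0
             then v i - (indeg i)^-1%:C * \sum_j (weight i j)%:C * v j
             else 0].

Lemma laplace_fun_is_linear G : linear (@laplace_fun G).
Proof.
move=> a u v; apply/ffunP=> i; rewrite !ffunE.
case: ifP => _; last by rewrite scaler0 addr0.
have -> : \sum_j (weight i j)%:C * (a *: u + v) j
        = a * (\sum_j (weight i j)%:C * u j) + \sum_j (weight i j)%:C * v j.
  rewrite mulr_sumr -big_split; apply: eq_bigr => j _.
  by rewrite !ffunE mulrDr mulrCA.
by rewrite mulrDr mulrCA scalerBr opprD addrACA.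
Qed.

HB.instance Definition _ G :=
  GRing.isLinear.Build R[i] {ffun G -> R[i]^o} {ffun G -> R[i]^o} *:%R
    (@laplace_fun G) (@laplace_fun_is_linear G).

Definition laplacian G : 'End({ffun G -> R[i]^o}) := linfun (@laplace_fun G).

Definition spec G : pred R[i] := passmx.leigenvalue (laplacian G).

Definition rratio G (i : G) : R :=
  if indeg i != 0 then (\sum_j `|weight i j|) / `|indeg i| else 0.

(* All the ratios are nonnegative, so the default value 0 does not affect the
   maximum unless [G] has no vertex at all. *)
Definition rmax G : R := \big[Num.max/0]_(i : G) rratio i.

Definition strong_component G (C : {set G}) : Prop :=
  exists i : G, C = [set j | connect (@edge G) i j && connect (@edge G) j i].

Definition maximal G (C : {set G}) : Prop :=
  forall i, i \in C -> rratio i = rmax G.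

Definition isolated G (C : {set G}) : Prop :=
  forall i j, i \in C -> j \notin C -> weight i j = 0.

(* Meant for even [k] >= 2 only: for [k] <= 1 the type ['Z_k] of indices
   modulo [k] is not Z/kZ. Edges of both signs need not be present. *)
Definition anti_kpartite G (k : nat) : Prop :=
  (forall i : G, indeg i != 0) /\
  exists Vs : 'Z_k -> {set G},
    [/\ forall q, Vs q != set0,
        forall p q, p != q -> [disjoint Vs p & Vs q],
        \bigcup_q Vs q = [set: G] &
        forall q (i j : G), i \in Vs q -> weight i j != 0 ->
          (j \in Vs (q - 1) /\ weight i j / indeg i < 0) \/
          (j \in Vs (q + (k./2 - 1)%:R) /\ 0 < weight i j / indeg i)].

Definition has_anti_kpartite_component G (k : nat) : Prop :=
  exists C : {set G},
    [/\ strong_component C, isolated C, maximal C &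
        anti_kpartite (induced C) k].

(* The complex number exp(i t). *)
Definition expi (t : R) : R[i] := cos t +i* sin t.

End WeightedDigraph.

(* Main.v *)
Require Import Defs.
From HB Require Import structures.
From mathcomp Require Import all_boot all_order all_algebra.
From mathcomp Require Import complex.
From mathcomp Require Import reals trigo.
From mathcomp Require Import ring lra zify.

Set Implicit Arguments.
Unset Strict Implicit.
Unset Printing Implicit Defensive.

(** Write z = exp(2 pi i / k), or its conjugate, so that z ^+ (k/2) = -1. At a
vertex i of nonzero in-degree, the equation saying that v is an eigenfunction
for 1 + r z reads

      \sum_j (w_ij / d_i) v j = - r z (v i),

and the moduli |w_ij / d_i| sum to r(i) <= r. Everything turns on the relation
[in_phase], by which each term of the left-hand side points in the direction of
- z (v i); together with r(i) = r it implies the equation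
([in_phase_laplace]).

If the component is given, with classes V_q, put v = z^-1 ^+ q on V_q. The two
kinds of edges are precisely those for which v is in phase. This is an
eigenfunction of the component only, and the eigenvalue passes to the whole
graph because the component is isolated ([isolated_eigen_spec]).

Conversely, let v be an eigenfunction. Where its modulus is maximal, the
triangle inequality has to be an equality, so that r(i) = r and v is in phase
([in_phase_of_peak]); then v has the same modulus at all in-neighbours of i, and
the vertices of maximal modulus contain a strong component without incoming
edges ([source_component]). Along an edge into a vertex of this component v is
multiplied by z if the normalised weight is negative and by - z, which is also
a power of z, if it is positive. So the level sets of v on the component are
indexed by Z/k and carry the edges required of the classes V_q.

The extra conditions serve twice. They give 1 + r z <> 0, so that v vanishes
where the in-degree is zero; and they make every class nonempty. A vertex of
the component always has an in-neighbour with positive normalised weight, which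
makes the set of nonempty classes stable under the step k/2 - 1; this is a
generator of Z/k if k = 4m ([half_pred_sqr]). If r > 1 there is also an
in-neighbour with negative normalised weight, and the set is stable under the
step -1. *)

Import Order.TTheory GRing.Theory Num.Theory.
Local Open Scope ring_scope.
Local Open Scope complex_scope.

(** * The complex exponential on the unit circle *)

Lemma expiD (R : realType) (s t : R) : expi (s + t) = expi s * expi t.
Proof. by rewrite /expi cosD sinD [X in _ +i* X]addrC. Qed.

Lemma expi0 (R : realType) : expi (0 : R) = 1.
Proof. by rewrite /expi cos0 sin0. Qed.

Lemma expiMn (R : realType) (t : R) (n : nat) : expi (t *+ n) = expi t ^+ n.
Proof.
by elim: n => [|n IHn]; rewrite ?expi0 // mulrS expiD IHn exprS.
Qed.

Lemma expi_pi (R : realType) : expi (pi : R) = -1.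
Proof.
by rewrite /expi cospi sinpi; apply/eqP; rewrite eq_complex /= oppr0 !eqxx.
Qed.

Lemma expiN (R : realType) (t : R) : expi (- t) = (expi t)^-1.
Proof.
have e1 : expi t * expi (- t) = 1 by rewrite -expiD subrr expi0.
have t0 : expi t != 0.
  by apply: contra_eq_neq e1 => ->; rewrite mul0r eq_sym oner_eq0.
by apply: (mulfI t0); rewrite e1 divff.
Qed.

Lemma norm_expi (R : realType) (t : R) : `|expi t| = 1.
Proof. by rewrite normc_def /= cos2Dsin2 sqrtr1. Qed.

Lemma expi_half_order (R : realType) (k : nat) :
  (2 <= k)%N -> ~~ odd k -> expi (2 * pi / k%:R : R) ^+ k./2 = -1.
Proof.
move=> k2 ek; rewrite -expiMn -expi_pi; congr expi.
have kE : k%:R = 2 * (k./2)%:R :> R.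
  by rewrite -natrM mul2n even_halfK.
have h0 : (k./2)%:R != 0 :> R by rewrite pnatr_eq0 -lt0n half_gt0.
by rewrite -mulr_natr kE; field.
Qed.

Lemma expi_prim_root (R : realType) (k : nat) :
  (0 < k)%N -> k.-primitive_root (expi (2 * pi / k%:R : R)).
Proof.
move=> k0; have k0' : k%:R != 0 :> R by rewrite pnatr_eq0 -lt0n.
have zk : expi (2 * pi / k%:R : R) ^+ k = 1.
  have xE : (2 * pi / k%:R) *+ k = pi + pi :> R.
    by rewrite -[LHS]mulr_natr; field.
  by rewrite -expiMn xE expiD expi_pi mulrNN mulr1.
have [m pm mk] := prim_order_exists k0 zk.
suff Em : k = m by rewrite [X in X.-primitive_root _]Em.
apply/eqP; rewrite eqn_leq (dvdn_leq k0 mk) andbT leqNgt; apply/negP => ltmk.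
have m0 := prim_order_gt0 pm.
(* If z had a smaller order m, the angle 2 pi m / k would lie strictly between
   0 and 2 pi; halving it gives an angle in ]0, pi[, where sin cannot vanish. *)
have xE : (2 * pi / k%:R) *+ m = (pi * m%:R / k%:R) *+ 2 :> R.
  by rewrite -[LHS]mulr_natr -[RHS]mulr_natr; field.
have := prim_expr_order pm; rewrite -expiMn xE => /(congr1 (@complex.Re R)).
rewrite /= cos_mulr2n => c1.
have : 0 < sin (pi * m%:R / k%:R : R).
  apply: sin_gt0_pi; rewrite divr_gt0 ?mulr_gt0 ?pi_gt0 ?ltr0n //=.
  by rewrite ltr_pdivrMr ?ltr0n // ltr_pM2l ?pi_gt0 // ltr_nat.
suff /eqP -> : sin (pi * m%:R / k%:R : R) == 0 by rewrite ltxx.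
by rewrite -sqrf_eq0 sin2cos2; apply/eqP; lra.
Qed.

(** * Powers indexed by residues modulo k *)

Lemma expr_Zp_nat (F : nzRingType) (w : F) (k n : nat) :
  (1 < k)%N -> w ^+ k = 1 -> w ^+ (n%:R : 'Z_k) = w ^+ n.
Proof. by move=> k1 wk; rewrite val_Zp_nat // expr_mod. Qed.

Lemma expr_ZpD (F : nzRingType) (w : F) (k : nat) (p q : 'Z_k) :
  (1 < k)%N -> w ^+ k = 1 -> w ^+ (p + q)%R = w ^+ p * w ^+ q.
Proof.
move=> k1 wk; rewrite -{1}(natr_Zp p) -{1}(natr_Zp q) -natrD.
by rewrite expr_Zp_nat // exprD.
Qed.

Lemma half_order (F : nzRingType) (w : F) (k : nat) :
  ~~ odd k -> w ^+ k./2 = -1 -> w ^+ k = 1.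
Proof.
by move=> ek wh; rewrite -(even_halfK ek) -muln2 exprM wh sqrrN expr1n.
Qed.

Lemma unity_neq0 (F : fieldType) (w : F) (k : nat) :
  (0 < k)%N -> w ^+ k = 1 -> w != 0.
Proof.
move=> k0; apply: contra_eq_neq => ->.
by rewrite expr0n gtn_eqF // eq_sym oner_eq0.
Qed.

(** On the q-th cyclic class the eigenfunction will be w ^+ q with w = z^-1, so
this and the next lemma give its value on the two classes that may send edges
to class q: z times, respectively - z times, the value on class q. *)
Lemma expr_Zp_pred (F : fieldType) (w : F) (k : nat) (q : 'Z_k) :
  (1 < k)%N -> w ^+ k = 1 -> w ^+ (q - 1)%R = w^-1 * w ^+ q.
Proof.
move=> k1 wk; have w0 := unity_neq0 (ltnW k1) wk.
apply: (mulfI w0); rewrite mulVKf //.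
by rewrite -{1}(expr1 w) -{1}(expr_Zp_nat 1 k1 wk) -expr_ZpD // addrC subrK.
Qed.

Lemma expr_Zp_half (F : fieldType) (w : F) (k : nat) (q : 'Z_k) :
  (1 < k)%N -> ~~ odd k -> w ^+ k./2 = -1 ->
  w ^+ (q + (k./2 - 1)%:R)%R = - (w^-1 * w ^+ q).
Proof.
move=> k1 ek wh; have wk := half_order ek wh.
rewrite natrB ?half_gt0 // addrA expr_Zp_pred // expr_ZpD // expr_Zp_nat //.
by rewrite wh mulrN1 mulrN.
Qed.

(** A unit of Z/k generates the additive group, so that stepping by it visits
every residue. *)
Lemma Zp_unit_step_ind (k : nat) (P : 'Z_k -> Prop) (q0 s t : 'Z_k) :
  s * t = 1 -> P q0 -> (forall q, P q -> P (q + s)) -> forall q, P q.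
Proof.
move=> st P0 PS q; have Pn n : P (q0 + s *+ n).
  by elim: n => [|n IHn]; rewrite ?mulr0n ?addr0 // mulrSr addrA; apply: PS.
have := Pn (t * (q - q0)).
by rewrite -mulr_natr natr_Zp mulrA st mul1r addrC subrK.
Qed.

(** * Eigenvalues of the Laplacian *)

Lemma specP (R : realType) (G : wdigraph R) (a : R[i]) :
  reflect (exists2 v : {ffun G -> R[i]^o},
             v != 0 & forall i, laplace_fun v i = a * v i)
          (a \in spec G).
Proof.
have kerE (v : {ffun G -> R[i]^o}) :
  (v \in lker (laplacian G - a *: \1%VF)) = (laplace_fun v == a *: v).
  by rewrite memv_ker !lfun_simp subr_eq0.
apply: (iffP idP) => [|[v v0 ev]].
  rewrite unfold_in /passmx.leigenvalue /passmx.leigenspace -vpick0 => v0.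
  set v := vpick _ in v0; exists v => // i.
  have : v \in lker (laplacian G - a *: \1%VF) by apply: memv_pick.
  by rewrite kerE => /eqP ->; rewrite ffunE.
rewrite unfold_in /passmx.leigenvalue /passmx.leigenspace.
apply: contra_neq v0 => K0; apply/eqP; rewrite -memv0 -K0 kerE.
by apply/eqP/ffunP => i; rewrite ev ffunE.
Qed.

(** Its kernel is the space of functions vanishing on C. *)
Definition restrict (R : realType) (G : wdigraph R) (C : {set G})
  (f : {ffun G -> R[i]^o}) : {ffun G -> R[i]^o} :=
  [ffun i => if i \in C then f i else 0].

Lemma restrict_linear (R : realType) (G : wdigraph R) (C : {set G}) :
  linear (@restrict R G C).
Proof.
move=> a u v; apply/ffunP => i; rewrite !ffunE.
by case: ifP => _ //; rewrite scaler0 addr0.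
Qed.

HB.instance Definition _ (R : realType) (G : wdigraph R) (C : {set G}) :=
  GRing.isLinear.Build R[i] {ffun G -> R[i]^o} {ffun G -> R[i]^o} *:%R
    (@restrict R G C) (@restrict_linear R G C).

(** An eigenfunction of an isolated block need not extend by zero to one of the
whole graph, because the block may send edges outwards. Yet the functions
vanishing on C form a subspace F0 stable under T = Laplacian - a, and T maps v
into F0 as well; so T maps F0 + <v>, of dimension one more than F0, into F0 and
cannot be injective. *)
Lemma isolated_eigen_spec (R : realType) (G : wdigraph R) (C : {set G})
    (a : R[i]) (v : {ffun G -> R[i]^o}) (i0 : G) :
  isolated C -> i0 \in C -> v i0 != 0 ->
  (forall i, i \in C -> laplace_fun v i = a * v i) -> a \in spec G.
Proof.
move=> isoC i0C vi0 ev.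
pose T := laplacian G - a *: \1%VF; pose F0 := lker (linfun (restrict C)).
have F0P (f : {ffun G -> R[i]^o}) :
    reflect (forall i, i \in C -> f i = 0) (f \in F0).
  rewrite memv_ker lfunE /=; apply: (iffP eqP) => [f0 i iC|f0].
    by move/ffunP: f0 => /(_ i); rewrite !ffunE iC.
  by apply/ffunP => i; rewrite !ffunE; case: ifP => // /f0.
have TE (f : {ffun G -> R[i]^o}) i : T f i = laplace_fun f i - a * f i.
  by rewrite !lfun_simp !ffunE.
have TF0 (f : {ffun G -> R[i]^o}) : f \in F0 -> T f \in F0.
  move=> /F0P f0; apply/F0P => i iC; rewrite TE (f0 i iC) mulr0 subr0 ffunE.
  case: ifP => // _; rewrite f0 // big1 ?mulr0 ?subr0 // => j _.
  have [jC|jC] := boolP (j \in C); first by rewrite f0 ?mulr0.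
  by rewrite isoC ?mul0r.
have vF0 : v \notin F0.
  by apply/negP => /F0P /(_ _ i0C) /eqP; rewrite (negPf vi0).
have img : (T @: (F0 + <[v]>) <= F0)%VS.
  rewrite limgD limg_line subv_add -memvE; apply/andP; split.
    by apply/subvP => _ /memv_imgP [f fF0 ->]; apply: TF0.
  by apply/F0P => i iC; rewrite TE ev ?subrr.
have dimF : (\dim F0 < \dim (F0 + <[v]>))%N.
  rewrite ltnNge; apply/negP => le; case/negP: vF0.
  have /eqP -> : (F0 == F0 + <[v]>)%VS by rewrite eqEdim addvSl.
  exact: (subvP (addvSr F0 <[v]>)) (memv_line v).
rewrite unfold_in /passmx.leigenvalue /passmx.leigenspace -/T.
apply: contraTneq dimF => K0; rewrite -leqNgt -(limg_ker_dim T (F0 + <[v]>)).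
by rewrite K0 capv0 dimv0 add0n dimvS.
Qed.

(** * Phase alignment *)

(** Equality in the triangle inequality at i: every term of the average
of v over the in-neighbours of i is a nonnegative multiple of the one direction
- z * v i. The relation is linear in v, and so it also serves to check that an
explicit function is an eigenfunction. *)
Definition in_phase (R : realType) (G : wdigraph R) (z : R[i])
    (v : {ffun G -> R[i]^o}) (i : G) : Prop :=
  forall j, (weight i j / indeg i)%:C * v j
            = - (`|weight i j / indeg i|%:C * (z * v i)).

Lemma in_phase_neg (R : realType) (G : wdigraph R) (z : R[i])
    (v : {ffun G -> R[i]^o}) (i j : G) :
  in_phase z v i -> weight i j / indeg i < 0 -> v j = z * v i.
Proof.
move=> /(_ j) + wn; rewrite (ltr0_norm wn) rmorphN mulNr opprK; apply: mulfI.
by rewrite eq_complex /= eqxx andbT lt_eqF.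
Qed.

Lemma in_phase_pos (R : realType) (G : wdigraph R) (z : R[i])
    (v : {ffun G -> R[i]^o}) (i j : G) :
  in_phase z v i -> 0 < weight i j / indeg i -> v j = - (z * v i).
Proof.
move=> /(_ j) + wp; rewrite (gtr0_norm wp) -mulrN; apply: mulfI.
by rewrite eq_complex /= eqxx andbT gt_eqF.
Qed.

Lemma sum_ratio (R : realType) (G : wdigraph R) (i : G) :
  indeg i != 0 -> \sum_j weight i j / indeg i = 1.
Proof. by move=> d0; rewrite -mulr_suml divff. Qed.

Lemma sum_norm_ratio (R : realType) (G : wdigraph R) (i : G) :
  indeg i != 0 -> \sum_j `|weight i j / indeg i| = rratio i.
Proof.
move=> d0; rewrite /rratio d0 mulr_suml.
by apply: eq_bigr => j _; rewrite normrM normfV.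
Qed.

Lemma laplace_ratioE (R : realType) (G : wdigraph R)
    (v : {ffun G -> R[i]^o}) (i : G) :
  indeg i != 0 ->
  laplace_fun v i = v i - \sum_j (weight i j / indeg i)%:C * v j.
Proof.
move=> d0; rewrite ffunE d0 mulr_sumr; congr (_ - _).
by apply: eq_bigr => j _; rewrite [weight i j / _]mulrC rmorphM mulrA.
Qed.

Lemma in_phase_laplace (R : realType) (G : wdigraph R) (z : R[i])
    (v : {ffun G -> R[i]^o}) (i : G) :
  indeg i != 0 -> in_phase z v i ->
  laplace_fun v i = (1 + (rratio i)%:C * z) * v i.
Proof.
move=> d0 ph; rewrite laplace_ratioE // (eq_bigr _ (fun j _ => ph j)).
rewrite sumrN opprK -mulr_suml -rmorph_sum /= sum_norm_ratio //.
by rewrite mulrDl mul1r mulrA.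
Qed.

Lemma norm_realC (R : realType) (x : R) : `|x%:C| = `|x|%:C.
Proof. by rewrite normc_def /= expr0n addr0 sqrtr_sqr. Qed.

Lemma rratio_le_rmax (R : realType) (G : wdigraph R) (i : G) :
  rratio i <= rmax G.
Proof. exact: le_bigmax. Qed.

Lemma rmax_ge0 (R : realType) (G : wdigraph R) : 0 <= rmax G.
Proof. exact: bigmax_ge_id. Qed.

(** At a vertex where the modulus of v is maximal, the eigenvalue equation reads
\sum_j F j = r, where F j = - (w_ij / d_i) (v j / (z v i)) has modulus at most
H j = |w_ij / d_i|, and \sum_j H j = r(i) <= r. Hence the sums agree and the
triangle inequality is an equality, so that F j = H j for all j. A vertex of
in-degree zero is ruled out because the Laplacian vanishes there while the
eigenvalue and v i do not. *)
Lemma in_phase_of_peak (R : realType) (G : wdigraph R) (z : R[i])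
    (v : {ffun G -> R[i]^o}) (i : G) :
  `|z| = 1 -> 1 + (rmax G)%:C * z != 0 ->
  v i != 0 -> (forall j, `|v j| <= `|v i|) ->
  laplace_fun v i = (1 + (rmax G)%:C * z) * v i ->
  [/\ indeg i != 0, rratio i = rmax G & in_phase z v i].
Proof.
move=> z1 a0 vi0 vmax ev.
have d0 : indeg i != 0.
  apply: contraTneq isT => d0; move: ev; rewrite ffunE d0 eqxx /= => /esym/eqP.
  by rewrite mulf_eq0 (negPf a0) (negPf vi0).
have z0 : z != 0 by rewrite -normr_eq0 z1 oner_eq0.
pose F j := - ((weight i j / indeg i)%:C * v j / (z * v i)) : R[i].
pose H j := `|weight i j / indeg i|%:C : R[i].
have FH j : true -> `|F j| <= H j.
  move=> _; rewrite /F /H -norm_realC normrN !normrM normfV normrM z1 mul1r.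
  rewrite -mulrA ler_piMr //.
  by rewrite ler_pdivrMr ?normr_gt0 // mul1r.
have sumF : \sum_j F j = (rmax G)%:C.
  rewrite /F sumrN -mulr_suml; move: ev; rewrite laplace_ratioE //.
  set S := \sum_j _; move=> e; have -> : S = - ((rmax G)%:C * (z * v i)).
    apply: (addIr (- v i)).
    by rewrite -opprB -[X in X = _]opprK; rewrite e; ring.
  by rewrite mulNr opprK mulfK // mulf_neq0.
have sumH : \sum_j H j = (rratio i)%:C by rewrite -rmorph_sum /= sum_norm_ratio.
have req : rratio i = rmax G.
  apply/eqP; rewrite eq_le rratio_le_rmax /= -lecR -sumH.
  have -> : (rmax G)%:C = `|\sum_j F j|.
    by rewrite sumF ger0_norm // (lecR 0) rmax_ge0.
  by apply: le_trans (ler_norm_sum _ _ _) _; apply: ler_sum => j; apply: FH.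
split=> // j; have := normC_sum_upper FH _ (erefl : xpredT j).
rewrite sumF sumH req => /(_ erefl); rewrite /F /H => <-.
by rewrite mulNr opprK divfK // mulf_neq0.
Qed.

(** The normalised in-weights sum to 1. *)
Lemma exists_pos_in_edge (R : realType) (G : wdigraph R) (i : G) :
  indeg i != 0 -> exists j, 0 < weight i j / indeg i.
Proof.
move=> d0; apply/existsP; apply: contraT => /existsPn npos.
have := sum_ratio d0; have : \sum_j weight i j / indeg i <= 0.
  by apply: sumr_le0 => j _; rewrite leNgt npos.
by move=> /[swap] ->; rewrite ler10.
Qed.

(** Without a negative normalised in-weight, the sum of the moduli would be the
sum of the in-weights, namely 1. *)
Lemma exists_neg_in_edge (R : realType) (G : wdigraph R) (i : G) :
  1 < rratio i -> exists j, weight i j / indeg i < 0.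
Proof.
move=> r1; have d0 : indeg i != 0.
  by apply: contraTneq r1 => d0; rewrite /rratio d0 eqxx ltr10.
apply/existsP; apply: contraT => /existsPn nneg.
move: r1; rewrite -sum_norm_ratio //.
have -> : \sum_j `|weight i j / indeg i| = 1.
  rewrite -(sum_ratio d0); apply: eq_bigr => j _.
  by rewrite ger0_norm // leNgt nneg.
by rewrite ltxx.
Qed.

Lemma peak_exists (R : realType) (G : wdigraph R) (v : {ffun G -> R[i]^o}) :
  v != 0 -> exists2 i, v i != 0 & forall j, `|v j| <= `|v i|.
Proof.
move=> v0; have [i1 vi1] : exists i, v i != 0.
  apply/existsP; apply: contra_neqT v0 => /existsPn v0.
  by apply/ffunP => i; rewrite ffunE; apply/eqP; have := v0 i; rewrite negbK.
have rv : {in xpredT, forall i, `|v i| \is Num.real}.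
  by move=> i _; apply: normr_real.
have [i _ vmax] := real_arg_maxP (erefl : xpredT i1) rv.
exists i => [|j]; last exact: vmax.
by rewrite -normr_gt0 (lt_le_trans _ (vmax i1 isT)) // normr_gt0.
Qed.

(** * Source components *)

(** A property inherited by in-neighbours reaches all ancestors. *)
Lemma connect_closed_ind (R : realType) (G : wdigraph R) (P : G -> Prop)
    (i0 : G) :
  P i0 -> (forall i j, P i -> weight i j != 0 -> P j) ->
  forall j, connect (@edge R G) j i0 -> P j.
Proof.
move=> P0 PS j /connectP [p]; elim: p j => [|x p IHp] j /=.
  by move=> _ <-.
by case/andP => ejx px lastp; apply: PS ejx; apply: IHp.
Qed.

(** Among the ancestors of i0, a vertex i with the fewest ancestors works: each
ancestor of i has its ancestors among those of i, hence exactly those, so i is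
one of them and the two vertices are mutually reachable. Thus the ancestors of
i form a strong component, which no edge enters. *)
Lemma source_component (R : realType) (G : wdigraph R) (P : G -> Prop)
    (i0 : G) :
  P i0 -> (forall i j, P i -> weight i j != 0 -> P j) ->
  exists2 i : G, P i &
    let C := [set j | connect (@edge R G) i j && connect (@edge R G) j i] in
    isolated C /\ C = [set j | connect (@edge R G) j i].
Proof.
move=> P0 PS; pose anc (i : G) := [set j | connect (@edge R G) j i].
have ancP i : connect (@edge R G) i i0 -> P i by apply: connect_closed_ind.
case: (@arg_minnP _ i0 (fun i => connect (@edge R G) i i0) (fun i => #|anc i|)).
  exact: connect0.
move=> i ci0 imin; exists i; first exact: ancP.
have CE : [set j | connect (@edge R G) i j && connect (@edge R G) j i] = anc i.
  apply/setP => j; rewrite !inE andb_idl // => cji.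
  have sub : anc j \subset anc i.
    by apply/subsetP => x; rewrite !inE => /connect_trans; apply.
  have /eqP Eanc : anc j == anc i.
    by rewrite eqEcard sub imin // (connect_trans cji).
  have : i \in anc j by rewrite Eanc inE connect0.
  by rewrite inE.
split=> //; rewrite CE => x y; rewrite !inE => cxi ncy; apply/eqP.
by apply: contraNT ncy => wxy; apply: connect_trans cxi; apply: connect1.
Qed.

(** * Cyclic classes of a component *)

Lemma indeg_induced (R : realType) (G : wdigraph R) (C : {set G})
    (x : induced C) :
  isolated C -> indeg x = indeg (val x).
Proof.
move=> isoC; rewrite /indeg [RHS](bigID (mem C)) /= [X in _ + X]big1 ?addr0.
  exact: (esym (big_sub [in C] (weight (val x)))).
by move=> j jC; apply: isoC jC; apply: valP.
Qed.

Lemma invr_half_order (F : fieldType) (z : F) (n : nat) :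
  z ^+ n = -1 -> z^-1 ^+ n = -1.
Proof. by move=> zn; rewrite exprVn zn invrN invr1. Qed.

(** The function equal to z^-1 ^+ q on the q-th class is in phase at every
vertex of the component: an edge from class q - 1 carries the factor z and a
negative sign, an edge from class q + k/2 - 1 carries the factor - z and a
positive sign, because z ^+ k./2 = -1. *)
Lemma component_spec (R : realType) (G : wdigraph R) (k : nat) (z : R[i]) :
  (1 < k)%N -> ~~ odd k -> z ^+ k./2 = -1 ->
  has_anti_kpartite_component G k -> 1 + (rmax G)%:C * z \in spec G.
Proof.
move=> k1 ek zh [C [_ isoC maxC [d0 [Vs [Vne Vdis Vcov Vedge]]]]].
have wh := invr_half_order zh; have wk := half_order ek wh.
pose cls x := odflt 0 [pick q | x \in Vs q].
have clsE x q : x \in Vs q -> cls x = q.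
  rewrite /cls; case: pickP => [p xp xq|/(_ q) -> //] /=.
  apply/eqP; apply: contraLR isT => /Vdis /disjoint_setI0 /setP /(_ x).
  by rewrite !inE xp xq.
have clsP x : x \in Vs (cls x).
  have : x \in \bigcup_q Vs q by rewrite Vcov inE.
  by case/bigcupP => q _ xq; rewrite (clsE x q).
pose v : {ffun G -> R[i]^o} :=
  [ffun i => if insub i is Some x then z^-1 ^+ cls x else 0].
have vE x : v (val x) = z^-1 ^+ cls x by rewrite ffunE valK.
have [x0 _] := set0Pn _ (Vne 0).
have w0 := unity_neq0 (ltnW k1) wk.
apply: (@isolated_eigen_spec _ _ C _ v (val x0)) => // [|| i iC].
- exact: valP.
- by rewrite vE expf_neq0.
pose x : induced C := Sub i iC.
have di : indeg i != 0 by have := d0 x; rewrite indeg_induced.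
rewrite (in_phase_laplace (z := z)) ?maxC // => j.
have [->|wij] := eqVneq (weight i j) 0.
  by rewrite !mul0r normr0 mul0r oppr0.
have jC : j \in C by apply: contraNT wij => jC; rewrite isoC.
pose y : induced C := Sub j jC.
have [-> ->] : v i = z^-1 ^+ cls x /\ v j = z^-1 ^+ cls y by split; rewrite -vE.
have := Vedge _ x y (clsP x) wij; rewrite indeg_induced //.
case=> -[/clsE -> wsgn].
  by rewrite expr_Zp_pred // invrK (ltr0_norm wsgn) rmorphN mulNr opprK.
by rewrite expr_Zp_half // invrK (gtr0_norm wsgn) mulrN.
Qed.

(** The vertices where the modulus of an eigenfunction v is maximal are closed
under in-neighbours, so they contain a source component. On it, passing to an
in-neighbour multiplies v by z or - z, that is by a power of z; the classes are
therefore the level sets v = z^-1 ^+ q * v i. Classes propagate by the steps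
k/2 - 1 (positive edges, always present) and -1 (negative edges, present if
r > 1). The step -1 generates Z/k, and so does k/2 - 1 if it is its own inverse
modulo k; every class is then nonempty. *)
Lemma spec_component (R : realType) (G : wdigraph R) (k : nat) (z : R[i]) :
  (1 < k)%N -> ~~ odd k -> k.-primitive_root z -> z ^+ k./2 = -1 -> `|z| = 1 ->
  1 + (rmax G)%:C * z != 0 ->
  ((k./2 - 1)%:R * (k./2 - 1)%:R = 1 :> 'Z_k) \/ 1 < rmax G ->
  1 + (rmax G)%:C * z \in spec G -> has_anti_kpartite_component G k.
Proof.
move=> k1 ek pz zh z1 a0 gen /specP [v v0 ev].
have wh := invr_half_order zh; have wk := half_order ek wh.
have z0 : z != 0 by rewrite -normr_eq0 z1 oner_eq0.
pose peak i := v i != 0 /\ forall j, `|v j| <= `|v i|.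
have peakP i : peak i ->
    [/\ indeg i != 0, rratio i = rmax G & in_phase z v i].
  by case=> vi0 vmax; apply: in_phase_of_peak.
have edge_sign i j : peak i -> weight i j != 0 ->
    weight i j / indeg i < 0 \/ 0 < weight i j / indeg i.
  by case/peakP => d0 _ _ wij; apply/orP; rewrite -neq_lt mulf_neq0 ?invr_neq0.
have peakS i j : peak i -> weight i j != 0 -> peak j.
  move=> pki wij; have [d0 _ ph] := peakP i pki; have [vi0 vmax] := pki.
  have nj : `|v j| = `|v i|.
    case: (edge_sign i j pki wij) => [/(in_phase_neg ph)|/(in_phase_pos ph)] ->;
      by rewrite ?normrN normrM z1 mul1r.
  by split=> [|l]; rewrite ?nj // -normr_eq0 nj normr_eq0.
have [i0 vi0 vmax0] := peak_exists v0.
have [i pki /=] := source_component (conj vi0 vmax0 : peak i0) peakS.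
set C := [set j | _] => -[isoC CE].
have inC j : (j \in C) = connect (@edge R G) j i by rewrite CE inE.
have Cpeak j : j \in C -> peak j by rewrite inC; apply: connect_closed_ind.
have iC : i \in C by rewrite inC.
exists C; split=> //; first by exists i.
  by move=> j /Cpeak /peakP [].
have dE (x : induced C) : indeg x = indeg (val x) by apply: indeg_induced.
have wE (x y : induced C) : weight x y = weight (val x) (val y) by [].
split=> [x|]; first by rewrite dE; case: (peakP _ (Cpeak _ (valP x))).
pose Vs (q : 'Z_k) := [set x : induced C | v (val x) == z^-1 ^+ q * v i].
have Vneg q (x y : induced C) : x \in Vs q ->
    weight x y / indeg x < 0 -> y \in Vs (q - 1).
  rewrite dE !inE => /eqP vx wn; have [_ _ ph] := peakP _ (Cpeak _ (valP x)).
  by rewrite (in_phase_neg ph wn) vx expr_Zp_pred // invrK mulrA.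
have Vpos q (x y : induced C) : x \in Vs q ->
    0 < weight x y / indeg x -> y \in Vs (q + (k./2 - 1)%:R).
  rewrite dE !inE => /eqP vx wp; have [_ _ ph] := peakP _ (Cpeak _ (valP x)).
  by rewrite (in_phase_pos ph wp) vx expr_Zp_half // invrK mulrA mulNr.
have lift_nbr (x : induced C) j : weight (val x) j / indeg (val x) != 0 ->
    exists y : induced C,
      weight x y / indeg x = weight (val x) j / indeg (val x).
  move=> wj; have jC : j \in C.
    by apply: contraNT wj => /(isoC _ _ (valP x)) ->; rewrite mul0r.
  by exists (Sub j jC : induced C); rewrite dE.
have i_in : (Sub i iC : induced C) \in Vs 0.
  by rewrite inE /= expr0 mul1r.
have cover (x : induced C) : exists q, x \in Vs q.
  pose Q j := peak j /\ exists q : 'Z_k, v j = z^-1 ^+ q * v i.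
  suff QC : forall j, connect (@edge R G) j i -> Q j.
    have : val x \in C by apply: valP.
    by rewrite inC => /QC [_ [q vq]]; exists q; rewrite inE vq.
  apply: connect_closed_ind => [|a b [pa [q vq]] wab].
    by split=> //; exists 0; rewrite expr0 mul1r.
  split; first exact: peakS wab.
  have [_ _ ph] := peakP a pa.
  case: (edge_sign a b pa wab) => [/(in_phase_neg ph)|/(in_phase_pos ph)] ->.
    by exists (q - 1); rewrite expr_Zp_pred // invrK vq mulrA.
  by exists (q + (k./2 - 1)%:R); rewrite expr_Zp_half // invrK vq mulrA mulNr.
exists Vs; split.
- have V0 : Vs 0 != set0 by apply/set0Pn; exists (Sub i iC : induced C).
  case: gen => [gen|r1].
    apply: (Zp_unit_step_ind gen V0) => q /set0Pn [x xq]; apply/set0Pn.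
    have [d0 _ _] := peakP _ (Cpeak _ (valP x)).
    have [j wj] := exists_pos_in_edge d0.
    have [y wy] := lift_nbr x j (lt0r_neq0 wj).
    by exists y; apply: Vpos xq _; rewrite wy.
  have gen1 : (-1) * (-1) = 1 :> 'Z_k by rewrite mulrNN mulr1.
  apply: (Zp_unit_step_ind gen1 V0) => q /set0Pn [x xq]; apply/set0Pn.
  have [d0 rx _] := peakP _ (Cpeak _ (valP x)).
  have [j wj] : exists j, weight (val x) j / indeg (val x) < 0.
    by apply: exists_neg_in_edge; rewrite rx.
  have [y wy] := lift_nbr x j (ltr0_neq0 wj).
  by exists y; apply: Vneg xq _; rewrite wy.
- move=> p q pq; rewrite disjoints_subset; apply/subsetP => x; rewrite !inE.
  move=> /eqP ->; apply: contra_neqN pq => /eqP.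
  move=> /(mulIf (proj1 pki)); rewrite !exprVn => /invr_inj /eqP.
  rewrite (eq_prim_root_expr pz) => /eqP pq; apply: val_inj.
  by move: pq; rewrite !modn_small // -[X in (_ < X)%N](Zp_cast k1).
- apply/setP => x; rewrite inE; have [q xq] := cover x.
  by apply/bigcupP; exists q.
- move=> q x y xq wxy.
  have [wn|wp] := edge_sign _ _ (Cpeak _ (valP x)) wxy.
    by left; rewrite -wE -dE in wn *; split=> //; apply: Vneg xq wn.
  by right; rewrite -wE -dE in wp *; split=> //; apply: Vpos xq wp.
Qed.

(** For k = 4m the step k/2 - 1 = 2m - 1 is its own inverse modulo k, since
(2m - 1)^2 = (m - 1) 4m + 1. *)
Lemma half_pred_sqr (m k : nat) :
  (1 <= m)%N -> k = (4 * m)%N ->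
  (k./2 - 1)%:R * (k./2 - 1)%:R = 1 :> 'Z_k.
Proof.
move=> m1 kE; have k1 : (1 < k)%N by lia.
have kh : k./2 = (2 * m)%N by rewrite kE -[4%N]/(2 * 2)%N -mulnA mul2n doubleK.
have sqE : ((k./2 - 1) * (k./2 - 1) = (m - 1) * k + 1)%N by rewrite kh; nia.
apply: ord_inj; rewrite -natrM sqE -[1 in RHS]/(1%:R) !val_Zp_nat //.
by rewrite modnMDl.
Qed.

Theorem theorem7p3 (R : realType) (G : wdigraph R) (k : nat)
    (k_ge2 : (2 <= k)%N) (k_even : ~~ odd k) :
  (has_anti_kpartite_component G k ->
     1 + (rmax G)%:C * expi (2 * pi / k%:R) \in spec G /\
     1 + (rmax G)%:C * expi (- (2 * pi / k%:R)) \in spec G)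
  /\
  (1 + (rmax G)%:C * expi (2 * pi / k%:R) \in spec G /\
   1 + (rmax G)%:C * expi (- (2 * pi / k%:R)) \in spec G ->
   (exists m : nat, (1 <= m)%N /\ k = (4 * m)%N) \/
   (exists m : nat, k = (2 + 4 * m)%N /\ 1 < rmax G) ->
   has_anti_kpartite_component G k).
Proof.
have zh := expi_half_order R k_ge2 k_even.
split=> [hC|[sz _] cases].
  split; apply: component_spec hC => //.
  by rewrite expiN; apply: invr_half_order.
have pz := expi_prim_root R (ltnW k_ge2).
apply: (spec_component _ _ pz zh (norm_expi _) _ _ sz) => //; last first.
  case: cases => [[m [m1 kE]]|[m [_ r1]]]; last by right.
  by left; apply: half_pred_sqr m1 kE.
(* The eigenvalue 1 + r z vanishes only if r = 1 and z = -1, which r > 1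
   excludes, and so does k = 4m because then z ^+ 2m = -1. *)
apply/negP; rewrite addrC addr_eq0 => /eqP rz.
have r1 : rmax G = 1.
  apply: complexI; rewrite -[RHS](@normrN1 R[i]) -rz normrM norm_expi mulr1.
  by rewrite norm_realC ger0_norm ?rmax_ge0.
case: cases => [[m [m1 kE]]|[m [_]]]; last by rewrite r1 ltxx.
move: zh; move: rz; rewrite r1 mul1r => ->.
rewrite kE -[4%N]/(2 * 2)%N -mulnA mul2n doubleK exprM sqrrN !expr1n => /eqP.
by rewrite -subr_eq0 opprK -[1 + 1]/(2%:R) pnatr_eq0.
Qed.
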